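(* Let $E$ be a finite extension of $\mathbf{Q}_p$ with valuation ring $\mathcal{O}$, uniformizer $\varpi$, $\mathbf{F}=\mathcal{O}/\varpi$, and let $\sigma:G_\Sigma\to\mathrm{GL}_n(E)$ be an absolutely irreducible Galois representation. Suppose there is a $G_\Sigma$-stable $\mathcal{O}$-lattice $\Lambda$ in the space of $\sigma$ such that $\overline\sigma_\Lambda\cong\begin{bmatrix}\rho_1&*\\0&\rho_2\end{bmatrix}$ with $\rho_i:G_\Sigma\to\mathrm{GL}_{n_i}(\mathbf{F})$ ($i=1,2$) having scalar centralizer, $\rho_1$ semisimple, and such that no irreducible constituent of $\rho_1^{\mathrm{ss}}$ is isomorphic to any irreducible constituent of $\rho_2^{\mathrm{ss}}$. Then there exists a $G_\Sigma$-stable lattice $\Lambda'$ in the space of $\sigma$ such that $\overline\sigma_{\Lambda'}\cong\begin{bmatrix}\rho_1&*\\0&\rho_2\end{bmatrix}\not\cong\rho_1\oplus\rho_2$.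
   Context: $G_\Sigma$ is the Galois group of the maximal extension of $\mathbf{Q}$ unramified outside a finite set $\Sigma$ of primes (and $\infty$). $\overline\sigma_\Lambda$ denotes the reduction modulo $\varpi$ of the action on $\Lambda$. *)

(* Defs.v *)
From HB Require Import structures.
From mathcomp Require Import all_boot all_order all_algebra all_field.
From mathcomp Require Import boolp classical_sets.

Set Implicit Arguments.
Unset Strict Implicit.
Unset Printing Implicit Defensive.

Import Order.TTheory GRing.Theory Num.Theory.
Local Open Scope ring_scope.

(* [Zpadic] is the inverse limit of the rings Z/p^n, with residues represented
   by naturals [x n < p ^ n]. *)
Definition padic_compatible (p : nat) (x : nat -> nat) :=
  forall n, x n = (x n.+1 %% p ^ n)%N.

Record Zpadic (p : nat) (p_prime : prime p) := MkZpadic {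
  Zpadic_seq :> nat -> nat;
  Zpadic_seqP : `[< padic_compatible p Zpadic_seq >]
}.

HB.instance Definition _ (p : nat) (p_prime : prime p) :=
  [isSub for @Zpadic_seq p p_prime].
HB.instance Definition _ (p : nat) (p_prime : prime p) :=
  [Choice of Zpadic p_prime by <:].

Section PadicIntegers.
Variables (p : nat) (p_prime : prime p).
Implicit Types x y z : Zpadic p_prime.

Lemma Zpadic_compat x n : x n = (x n.+1 %% p ^ n)%N.
Proof. by have /asboolP := Zpadic_seqP x. Qed.

Lemma Zpadic_small x n : (x n %% p ^ n)%N = x n.
Proof. by rewrite Zpadic_compat modn_mod. Qed.

Lemma Zpadic_trunc_le x m n : (m <= n)%N -> (x n %% p ^ m)%N = x m.
Proof.
elim: n => [|n IHn]; first by rewrite leqn0 => /eqP->; exact: Zpadic_small.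
rewrite leq_eqVlt => /orP[/eqP->|]; first exact: Zpadic_small.
rewrite ltnS => lemn; rewrite -(IHn lemn) (Zpadic_compat x n) modn_dvdm //.
exact: dvdn_exp2l.
Qed.

Lemma Zpadic_inj x y : (forall n, x n = y n) -> x = y.
Proof. by move=> exy; apply/val_inj/funext. Qed.

Lemma modSX a n : ((a %% p ^ n.+1) %% p ^ n = a %% p ^ n)%N.
Proof. by rewrite modn_dvdm // dvdn_exp2l. Qed.

Definition Zpadic_of (f : nat -> nat)
    (fP : forall n, (f n.+1 = f n %[mod p ^ n])%N) : Zpadic p_prime.
Proof.
apply: (@MkZpadic _ _ (fun n => f n %% p ^ n)%N).
by apply/asboolP => n; rewrite modSX fP.
Defined.

Lemma Zpadic_ofE f fP n : @Zpadic_of f fP n = (f n %% p ^ n)%N. Proof. by []. Qed.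

Lemma Zpadic_const_subproof a n : (a = a %[mod p ^ n])%N. Proof. by []. Qed.
Lemma Zpadic_add_subproof x y n :
  (x n.+1 + y n.+1 = x n + y n %[mod p ^ n])%N.
Proof. by rewrite (Zpadic_compat x n) (Zpadic_compat y n) modnDm. Qed.
Lemma Zpadic_mul_subproof x y n :
  (x n.+1 * y n.+1 = x n * y n %[mod p ^ n])%N.
Proof. by rewrite (Zpadic_compat x n) (Zpadic_compat y n) modnMm. Qed.

Lemma Zpadic_le x n : (x n <= p ^ n)%N.
Proof. by rewrite -Zpadic_small ltnW // ltn_mod expn_gt0 prime_gt0. Qed.

Lemma Zpadic_opp_subproof x n :
  (p ^ n.+1 - x n.+1 = p ^ n - x n %[mod p ^ n])%N.
Proof.
apply/eqP; rewrite -(eqn_modDr (x n.+1)) subnK ?Zpadic_le //.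
rewrite -modnDmr -Zpadic_compat subnK ?Zpadic_le // modnn.
by rewrite -/(dvdn _ _) dvdn_exp2l.
Qed.

Definition Zpadic_zero : Zpadic p_prime := Zpadic_of (Zpadic_const_subproof 0).
Definition Zpadic_one : Zpadic p_prime := Zpadic_of (Zpadic_const_subproof 1).
Definition Zpadic_add x y : Zpadic p_prime := Zpadic_of (Zpadic_add_subproof x y).
Definition Zpadic_mul x y : Zpadic p_prime := Zpadic_of (Zpadic_mul_subproof x y).
Definition Zpadic_opp x : Zpadic p_prime := Zpadic_of (Zpadic_opp_subproof x).

Lemma Zpadic_addA : associative Zpadic_add.
Proof. by move=> x y z; apply: Zpadic_inj => n /=; rewrite modnDml modnDmr addnA. Qed.
Lemma Zpadic_addC : commutative Zpadic_add.
Proof. by move=> x y; apply: Zpadic_inj => n /=; rewrite addnC. Qed.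
Lemma Zpadic_add0 : left_id Zpadic_zero Zpadic_add.
Proof. by move=> x; apply: Zpadic_inj => n /=; rewrite mod0n Zpadic_small. Qed.
Lemma Zpadic_addN : left_inverse Zpadic_zero Zpadic_opp Zpadic_add.
Proof.
by move=> x; apply: Zpadic_inj => n /=; rewrite modnDml subnK ?Zpadic_le // modnn mod0n.
Qed.
Lemma Zpadic_mulA : associative Zpadic_mul.
Proof. by move=> x y z; apply: Zpadic_inj => n /=; rewrite modnMml modnMmr mulnA. Qed.
Lemma Zpadic_mulC : commutative Zpadic_mul.
Proof. by move=> x y; apply: Zpadic_inj => n /=; rewrite mulnC. Qed.
Lemma Zpadic_mul1 : left_id Zpadic_one Zpadic_mul.
Proof. by move=> x; apply: Zpadic_inj => n /=; rewrite modnMml mul1n Zpadic_small. Qed.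
Lemma Zpadic_mulD : left_distributive Zpadic_mul Zpadic_add.
Proof. by move=> x y z; apply: Zpadic_inj => n /=; rewrite modnMml mulnDl modnDm. Qed.
Lemma Zpadic_one_neq0 : Zpadic_one != Zpadic_zero.
Proof.
apply/eqP => /(congr1 (fun x : Zpadic _ => x 1%N)) /=.
by rewrite expn1 mod0n modn_small // prime_gt1.
Qed.

HB.instance Definition _ :=
  GRing.isZmodule.Build (Zpadic p_prime) Zpadic_addA Zpadic_addC Zpadic_add0 Zpadic_addN.
HB.instance Definition _ := GRing.Zmodule_isComNzRing.Build (Zpadic p_prime)
  Zpadic_mulA Zpadic_mulC Zpadic_mul1 Zpadic_mulD Zpadic_one_neq0.

Definition Zpadic_unit : {pred Zpadic p_prime} := fun x => `[< exists y, y * x = 1 >].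
Definition Zpadic_inv x : Zpadic p_prime :=
  if pselect (exists y, y * x = 1) is left xU then projT1 (cid xU) else x.

Lemma Zpadic_mulV : {in Zpadic_unit, left_inverse 1 Zpadic_inv *%R}.
Proof.
by move=> x /asboolP xU; rewrite /Zpadic_inv; case: pselect => // yU; case: cid.
Qed.
Lemma Zpadic_unitP x y : y * x = 1 -> x \in Zpadic_unit.
Proof. by move=> yx1; apply/asboolP; exists y. Qed.
Lemma Zpadic_inv_out : {in [predC Zpadic_unit], Zpadic_inv =1 id}.
Proof. by move=> x /asboolPn xU; rewrite /Zpadic_inv; case: pselect. Qed.

HB.instance Definition _ := GRing.ComNzRing_hasMulInverse.Build (Zpadic p_prime)
  Zpadic_mulV Zpadic_unitP Zpadic_inv_out.

Lemma Zpadic_neq0 x : x != 0 -> exists n, ~~ (p ^ n %| x n)%N.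
Proof.
move=> x0; apply: contrapT => /forallNP xE; case/eqP: x0.
by apply: Zpadic_inj => n /=; rewrite mod0n -Zpadic_small; apply/eqP/negPn/negP/xE.
Qed.

Lemma dvdn_pX_mul m n a b :
  (p ^ (m + n) %| a * b)%N -> (p ^ m %| a)%N || (p ^ n %| b)%N.
Proof.
have [->|a0] := posnP a; first by rewrite dvdn0.
have [->|b0] := posnP b; first by rewrite dvdn0 orbT.
rewrite !pfactor_dvdn // ?muln_gt0 ?a0 // lognM //.
by case: (leqP m) => //= lta; apply: contraLR; rewrite -!ltnNge => ltb; rewrite -addSn leq_add // ltnW.
Qed.

Lemma Zpadic_idomain x y : x * y = 0 -> (x == 0) || (y == 0).
Proof.
move=> xy0; apply/negPn; rewrite negb_or; apply/negP => /andP[/Zpadic_neq0[m xm]].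
move=> /Zpadic_neq0[n yn].
have := congr1 (fun z : Zpadic _ => z (m + n)%N) xy0; rewrite /= mod0n => /eqP.
case/dvdn_pX_mul/orP=> /eqP.
- rewrite (Zpadic_trunc_le x (leq_addr n m)) => xm0.
  by rewrite /dvdn Zpadic_small xm0 in xm.
- rewrite (Zpadic_trunc_le y (leq_addl m n)) => yn0.
  by rewrite /dvdn Zpadic_small yn0 in yn.
Qed.

HB.instance Definition _ :=
  GRing.ComUnitRing_isIntegral.Build (Zpadic p_prime) Zpadic_idomain.

End PadicIntegers.

Definition Qpadic (p : nat) (p_prime : prime p) : fieldType :=
  {fraction Zpadic p_prime}.

(* Every finite extension E of Q_p carries exactly one such valuation, the
   extension of the p-adic valuation normalised so as to be onto the integers.
   The value [v 0] is irrelevant. *)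
Record padic_valuation (p : nat) (p_prime : prime p)
    (E : fieldExtType (Qpadic p_prime)) := PadicValuation {
  pval :> E -> int;
  pvalM : forall x y, x != 0 -> y != 0 -> pval (x * y) = pval x + pval y;
  pvalD : forall x y, x != 0 -> y != 0 -> x + y != 0 ->
    Num.min (pval x) (pval y) <= pval (x + y);
  pval_onto : exists2 x, x != 0 & pval x = 1;
  pval_ge0 : forall a : Qpadic p_prime, a != 0 ->
    (0 <= pval a%:A <-> exists b : Zpadic p_prime, a = @FracField.tofrac _ b)
}.

Section ValuationRing.
Variables (p : nat) (p_prime : prime p) (E : fieldExtType (Qpadic p_prime)).
Variable v : padic_valuation E.

Definition vball (k : int) : {pred E} := [pred x | (x == 0) || (k <= v x)].

Lemma pval1 : v 1 = 0.
Proof.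
have := @pvalM _ _ _ v 1 1 (oner_neq0 _) (oner_neq0 _).
by rewrite mulr1 => /eqP; rewrite -subr_eq0 opprD addNKr oppr_eq0 => /eqP.
Qed.

Lemma pvalN1 : v (- 1) = 0.
Proof.
have n1 : (- 1 : E) != 0 by rewrite oppr_eq0 oner_neq0.
have := @pvalM _ _ _ v _ _ n1 n1; rewrite mulrNN mulr1 pval1 => /esym/eqP.
by rewrite -mulr2n mulrn_eq0 /= => /eqP.
Qed.

Lemma pvalV x : x != 0 -> v x^-1 = - v x.
Proof.
move=> x0; have := @pvalM _ _ _ v _ _ x0 (invr_neq0 x0).
by rewrite divff // pval1 => /esym/eqP; rewrite addrC addr_eq0 => /eqP.
Qed.

Lemma vball_add k x y : x \in vball k -> y \in vball k -> x + y \in vball k.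
Proof.
rewrite !inE; have [->|x0] := eqVneq x 0; first by rewrite add0r.
have [->|y0] := eqVneq y 0; first by rewrite addr0 => ? _; rewrite (negPf x0).
have [//|xy0] := eqVneq (x + y) 0; rewrite /= => kx ky.
by apply: le_trans _ (pvalD v x0 y0 xy0); rewrite le_min kx.
Qed.

Lemma vball_mul k l x y :
  x \in vball k -> y \in vball l -> x * y \in vball (k + l).
Proof.
rewrite !inE mulf_eq0; have [//|x0] := eqVneq x 0.
have [//|y0] /= := eqVneq y 0.
by rewrite pvalM //; exact: lerD.
Qed.

Lemma vball_subring : subring_closed (vball 0).
Proof.
split=> [|x y Ox Oy|x y Ox Oy].
- by rewrite !inE pval1 lexx orbT.
- rewrite vball_add //; rewrite -mulN1r -[0](addr0 0) vball_mul //.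
  by rewrite !inE pvalN1 lexx orbT.
- by rewrite -[0](addr0 0) vball_mul.
Qed.

HB.instance Definition _ :=
  GRing.isSubringClosed.Build E (vball 0) vball_subring.

Record vring := MkVring { vring_val :> E; vringP : vring_val \in vball 0 }.

HB.instance Definition _ := [isSub for vring_val].
HB.instance Definition _ := [Choice of vring by <:].
HB.instance Definition _ := [SubChoice_isSubComNzRing of vring by <:].

Record uniformizer := Uniformizer {
  unif :> vring;
  unif_neq0 : unif != 0;
  pval_unif : v (val unif) = 1
}.

Variable pi : uniformizer.

Definition unif_ideal : {pred vring} :=
  fun x => `[< exists y, x = unif pi * y >].

Lemma unif_idealE x : (x \in unif_ideal) = (val x \in vball 1).
Proof.
have pi0 : val (unif pi) != 0 by exact: unif_neq0.
apply/asboolP/idP => [[y ->]|].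
  rewrite rmorphM -[1](addr0 1) vball_mul ?vringP //.
  by rewrite inE pval_unif lexx orbT.
rewrite inE => vx.
suff Oy : val x / val (unif pi) \in vball 0.
  by exists (MkVring Oy); apply/val_inj; rewrite rmorphM /= mulrC divfK.
rewrite inE; have [->|x0] := eqVneq (val x) 0; first by rewrite mul0r eqxx.
rewrite (negPf x0) /= in vx.
by rewrite pvalM ?invr_eq0 // pvalV // pval_unif subr_ge0 vx orbT.
Qed.

Lemma unif_ideal_closed : idealr_closed unif_ideal.
Proof.
split=> [||a x y].
- by apply/asboolP; exists 0; rewrite mulr0.
- by rewrite unif_idealE rmorph1 inE oner_eq0 pval1.
- move=> /asboolP[x' ->] /asboolP[y' ->]; apply/asboolP.
  by exists (a * x' + y'); rewrite mulrDr mulrCA.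
Qed.

HB.instance Definition _ := isIdealr.Build vring unif_ideal unif_ideal_closed.

Definition residue_field := {ideal_quot unif_ideal}.
HB.instance Definition _ := GRing.ComNzRing.on residue_field.

Definition red (x : vring) : residue_field := (\pi_residue_field x)%qT.

Lemma red_zmod_morphism : zmod_morphism red.
Proof. by move=> x y; rewrite /red !piE. Qed.
Lemma red_monoid_morphism : monoid_morphism red.
Proof. by split=> [|x y]; rewrite /red !piE. Qed.

HB.instance Definition _ :=
  GRing.isZmodMorphism.Build vring residue_field red red_zmod_morphism.
HB.instance Definition _ :=
  GRing.isMonoidMorphism.Build vring residue_field red red_monoid_morphism.

Lemma red_eq0 x : (red x == 0) = (x \in unif_ideal).
Proof.
by rewrite /red piE Quotient.equivE subr0.
Qed.

Lemma residue_inv_subproof (a : residue_field) :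
  a != 0 -> exists b : residue_field, b * a = 1.
Proof.
rewrite -[a]reprK -/(red _) red_eq0 unif_idealE; set x := repr a => vx.
have x0 : val x != 0 by apply: contraNneq vx => ->; rewrite inE eqxx.
have Vx : v (val x) = 0.
  have := vringP x; move: vx; rewrite !inE (negPf x0) /= -ltNge.
  by move=> lt1 ge0; apply/eqP; rewrite eq_le ge0 andbT -ltzD1 add0r.
have Oy : (val x)^-1 \in vball 0 by rewrite inE pvalV // Vx oppr0 lexx orbT.
exists (red (MkVring Oy)); apply/eqP; rewrite /red piE Quotient.equivE.
suff -> : MkVring Oy * x - 1 = 0 by exact: idealr0.
by apply/eqP; rewrite subr_eq0; apply/eqP/val_inj; rewrite rmorphM /= mulVf.
Qed.

Definition residue_inv (a : residue_field) : residue_field :=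
  if pselect (a != 0) is left a0 then projT1 (cid (residue_inv_subproof a0))
  else 0.

Lemma residue_mulVf a : a != 0 -> residue_inv a * a = 1.
Proof. by rewrite /residue_inv; case: pselect => // a0 _; case: cid. Qed.

Lemma residue_inv0 : residue_inv 0 = 0.
Proof. by rewrite /residue_inv; case: pselect => // n0; case/eqP: {-}(n0). Qed.

HB.instance Definition _ :=
  GRing.ComNzRing_isField.Build residue_field residue_mulVf residue_inv0.

End ValuationRing.

(* Algebraic extensions of Q are taken inside [algC], an algebraic closure
   of Q. *)
Definition number_field (K : {pred algC}) :=
  divring_closed K /\ exists s : seq algC, {subset K <= Crat_span s}.

Definition integers (K : {pred algC}) : set algC :=
  [set x | x \in K /\ x \in Aint].

Definition prime_ideal (K : {pred algC}) (P : set algC) :=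
  [/\ (P `<=` integers K)%classic, P 0, ~ P 1,
      forall a x y, integers K a -> P x -> P y -> P (a * x + y)
    & forall x y, integers K x -> integers K y -> P (x * y) -> P x \/ P y].

Definition ideal_square (P : set algC) : set algC :=
  [set x | exists2 s : seq (algC * algC),
    (forall c, c \in s -> P c.1 /\ P c.2) & x = \sum_(c <- s) c.1 * c.2].

(* Residue extensions are finite, hence separable, so that q is unramified in K
   iff every prime above q has ramification index 1. *)
Definition unramified_at (q : nat) (K : {pred algC}) :=
  forall P, prime_ideal K P -> P q%:R -> ~ ideal_square P q%:R.

(* The archimedean place imposes no condition. *)
Definition unramified_outside (S : seq nat) (K : {pred algC}) :=
  forall q, prime q -> q \notin S -> unramified_at q K.

(* The compositum of all number fields unramified outside S. *)
Definition in_QS (S : seq nat) : {pred algC} := fun x =>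
  `[< forall M : {pred algC}, divring_closed M ->
        (forall K, number_field K -> unramified_outside S K ->
           {subset K <= M}) ->
        x \in M >].

Lemma in_QS_divring (S : seq nat) : divring_closed (in_QS S).
Proof.
split=> [|x y /asboolP QSx /asboolP QSy|x y /asboolP QSx /asboolP QSy];
  apply/asboolP => M Mdiv MS; have [M1 MB MV] := Mdiv => //.
- by apply: MB; [exact: QSx|exact: QSy].
- by apply: MV; [exact: QSx|exact: QSy].
Qed.

HB.instance Definition _ (S : seq nat) :=
  GRing.isDivringClosed.Build algC (in_QS S) (in_QS_divring S).

Record QS (S : seq nat) := MkQS { QS_val :> algC; QSP : QS_val \in in_QS S }.

HB.instance Definition _ S := [isSub for @QS_val S].
HB.instance Definition _ S := [Choice of QS S by <:].
HB.instance Definition _ S := [SubChoice_isSubIntegralDomain of QS S by <:].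
HB.instance Definition _ S := [SubIntegralDomain_isSubField of QS S by <:].

(* Field automorphisms of QS are automatically Q-linear. *)
Definition field_automorphism (F : fieldType) (f : F -> F) :=
  [/\ zmod_morphism f, monoid_morphism f & bijective f].

Record GS (S : seq nat) := MkGS {
  GS_fun :> QS S -> QS S;
  GSP : `[< field_automorphism GS_fun >]
}.

HB.instance Definition _ S := [isSub for @GS_fun S].
HB.instance Definition _ S := [Choice of GS S by <:].

Section GaloisGroup.
Variable S : seq nat.
Implicit Types f g h : GS S.

Lemma GS_bij g : bijective g.
Proof. by have /asboolP[] := GSP g. Qed.

Lemma GS_one_subproof : `[< field_automorphism (@idfun (QS S)) >].
Proof. by apply/asboolP; split=> //; exists idfun. Qed.
Definition GS_one : GS S := MkGS GS_one_subproof.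

Lemma GS_mul_subproof f g : `[< field_automorphism (f \o g) >].
Proof.
have /asboolP[fB [f1 fM] fbij] := GSP f.
have /asboolP[gB [g1 gM] gbij] := GSP g.
apply/asboolP; split; last exact: bij_comp.
- by move=> x y /=; rewrite gB fB.
- by split=> [|x y] /=; rewrite ?g1 ?gM ?f1 ?fM.
Qed.
Definition GS_mul f g : GS S := MkGS (GS_mul_subproof f g).

Lemma GS_inv_ex f : exists g : GS S, cancel f g /\ cancel g f.
Proof.
have /asboolP[fB [f1 fM] fbij] := GSP f; have [g fK gK] := fbij.
have gP : `[< field_automorphism g >].
  apply/asboolP; split; last by exists f.
  - by move=> x y; apply: (can_inj fK); rewrite fB !gK.
  - by split=> [|x y]; apply: (can_inj fK); rewrite ?f1 ?fM !gK.
by exists (MkGS gP).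
Qed.
Definition GS_inv f : GS S := projT1 (cid (GS_inv_ex f)).

Lemma GS_mulA : associative GS_mul.
Proof. by move=> f g h; apply/val_inj. Qed.
Lemma GS_mul1 : left_id GS_one GS_mul.
Proof. by move=> f; apply/val_inj. Qed.
Lemma GS_mulr1 : right_id GS_one GS_mul.
Proof. by move=> f; apply/val_inj. Qed.
Lemma GS_mulV : left_inverse GS_one GS_inv GS_mul.
Proof.
move=> f; apply/val_inj/funext => x; rewrite /= /GS_inv.
by case: cid => g /= [fK _]; exact: fK.
Qed.
Lemma GS_mulVr : right_inverse GS_one GS_inv GS_mul.
Proof.
move=> f; apply/val_inj/funext => x; rewrite /= /GS_inv.
by case: cid => g /= [_ gK]; exact: gK.
Qed.

HB.instance Definition _ :=
  isGroup.Build (GS S) GS_mulA GS_mul1 GS_mulr1 GS_mulV GS_mulVr.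

End GaloisGroup.

(* Matrices act on column vectors, so that in a block upper triangular
   representation the top left block is the subrepresentation. *)
Definition is_rep (G : groupType) (R : comNzRingType) (d : nat)
    (rho : G -> 'M[R]_d) :=
  rho 1%g = 1%:M /\ forall g h, rho (g * h)%g = rho g *m rho h.

Definition rep_iso (G : groupType) (K : fieldType) (d e : nat)
    (rho : G -> 'M[K]_d) (tau : G -> 'M[K]_e) :=
  exists (P : 'M[K]_(e, d)) (Q : 'M[K]_(d, e)),
    [/\ P *m Q = 1%:M, Q *m P = 1%:M & forall g, P *m rho g = tau g *m P].

Definition stable (G : groupType) (K : fieldType) (d : nat)
    (rho : G -> 'M[K]_d) (U : {vspace 'cV[K]_d}) :=
  forall g x, x \in U -> rho g *m x \in U.

Definition irreducible (G : groupType) (K : fieldType) (d : nat)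
    (rho : G -> 'M[K]_d) :=
  (0 < d)%N /\ forall U, stable rho U -> U = 0%VS \/ U = fullv.

Definition absolutely_irreducible (G : groupType) (K : fieldType) (d : nat)
    (rho : G -> 'M[K]_d) :=
  forall (K' : fieldType) (f : {rmorphism K -> K'}),
    irreducible (fun g => map_mx f (rho g)).

Definition semisimple (G : groupType) (K : fieldType) (d : nat)
    (rho : G -> 'M[K]_d) :=
  forall U, stable rho U ->
    exists W, [/\ stable rho W, (U + W)%VS = fullv & (U :&: W)%VS = 0%VS].

(* In a suitable basis, rho preserves the filtration whose k-th step is spanned
   by the basis vectors of weight at most k; rho^ss is the associated graded
   representation, provided that the latter is semisimple. *)
Definition semisimplification (G : groupType) (K : fieldType) (d : nat)
    (rho rho_ss : G -> 'M[K]_d) :=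
  semisimple rho_ss /\
  exists (tau : G -> 'M[K]_d) (w : 'I_d -> nat),
    [/\ rep_iso rho tau,
        forall g i j, (w j < w i)%N -> tau g i j = 0
      & rep_iso rho_ss
          (fun g => \matrix_(i, j) (if w i == w j then tau g i j else 0))].

(* tau is irreducible and isomorphic to a subquotient of rho: the matrix T
   induces a surjective equivariant map from U. *)
Definition irreducible_constituent (G : groupType) (K : fieldType) (d m : nat)
    (rho : G -> 'M[K]_d) (tau : G -> 'M[K]_m) :=
  irreducible tau /\
  exists (U : {vspace 'cV[K]_d}) (T : 'M[K]_(m, d)),
    [/\ stable rho U,
        forall g x, x \in U -> T *m (rho g *m x) = tau g *m (T *m x)
      & forall y : 'cV[K]_m, exists2 x, x \in U & y = T *m x].

Definition scalar_centralizer (G : groupType) (K : fieldType) (d : nat)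
    (rho : G -> 'M[K]_d) :=
  forall M : 'M[K]_d, (forall g, M *m rho g = rho g *m M) -> is_scalar_mx M.

Definition block_rep (G : groupType) (K : fieldType) (d1 d2 : nat)
    (rho1 : G -> 'M[K]_d1) (b : G -> 'M[K]_(d1, d2)) (rho2 : G -> 'M[K]_d2) :
    G -> 'M[K]_(d1 + d2) :=
  fun g => block_mx (rho1 g) (b g) 0 (rho2 g).

Definition dsum_rep (G : groupType) (K : fieldType) (d1 d2 : nat)
    (rho1 : G -> 'M[K]_d1) (rho2 : G -> 'M[K]_d2) : G -> 'M[K]_(d1 + d2) :=
  block_rep rho1 (fun=> 0) rho2.

(* [nbhs0 k], for k in nat, is to be a basis of neighbourhoods of 0 in K.  The
   Krull topology on GS has as basis of neighbourhoods of g the sets of those h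
   that agree with g on a finite subset of QS. *)
Definition continuous_rep (S : seq nat) (K : fieldType) (nbhs0 : nat -> {pred K})
    (d : nat) (rho : GS S -> 'M[K]_d) :=
  forall (g : GS S) (k : nat), exists s : seq (QS S),
    forall h : GS S, {in s, h =1 g} ->
      forall i j, rho h i j - rho g i j \in nbhs0 k.

Definition galois_rep (S : seq nat) (p : nat) (p_prime : prime p)
    (E : fieldExtType (Qpadic p_prime)) (v : padic_valuation E) (d : nat)
    (rho : GS S -> 'M[E]_d) :=
  is_rep rho /\ continuous_rep (fun k => vball v k%:Z) rho.

Definition residual_galois_rep (S : seq nat) (p : nat) (p_prime : prime p)
    (E : fieldExtType (Qpadic p_prime)) (v : padic_valuation E)
    (pi : uniformizer v) (d : nat)
    (rho : GS S -> 'M[residue_field pi]_d) :=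
  is_rep rho /\ continuous_rep (fun=> pred1 0) rho.

Section Lattices.
Variables (p : nat) (p_prime : prime p) (E : fieldExtType (Qpadic p_prime)).
Variable v : padic_valuation E.

Definition col_span n m (B : 'M[E]_(n, m)) : set 'cV[E]_n :=
  [set x | exists c : 'cV[vring v]_m, x = B *m map_mx val c].

(* A finitely generated O-submodule spanning E^n: [row_free B] says that B has
   rank n, that is, that its columns span E^n. *)
Definition lattice n (L : set 'cV[E]_n) :=
  exists m (B : 'M[E]_(n, m)), row_free B /\ L = col_span B.

(* The columns of B form an O-basis of L: [row_full B] says that they are
   linearly independent. *)
Definition lattice_basis n m (L : set 'cV[E]_n) (B : 'M[E]_(n, m)) :=
  row_full B /\ L = col_span B.

Definition lattice_stable (G : groupType) n (sigma : G -> 'M[E]_n)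
    (L : set 'cV[E]_n) :=
  forall g x, L x -> L (sigma g *m x).

Variable pi : uniformizer v.

(* tau is the matrix of the action of G on L / pi L with respect to the image
   of an O-basis of L. *)
Definition reduction_matrix (G : groupType) n m (sigma : G -> 'M[E]_n)
    (L : set 'cV[E]_n) (tau : G -> 'M[residue_field pi]_m) :=
  exists (B : 'M[E]_(n, m)) (A : G -> 'M[vring v]_m),
    [/\ lattice_basis L B,
        forall g, sigma g *m B = B *m map_mx val (A g)
      & forall g, tau g = map_mx (red pi) (A g)].

Definition reduction_iso (G : groupType) n m (sigma : G -> 'M[E]_n)
    (L : set 'cV[E]_n) (tau : G -> 'M[residue_field pi]_m) :=
  exists tau0 : G -> 'M[residue_field pi]_m,
    reduction_matrix sigma L tau0 /\ rep_iso tau0 tau.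

End Lattices.

(* Main.v *)
Require Import Defs.
From HB Require Import structures.
From mathcomp Require Import all_boot all_order all_algebra all_field.
From mathcomp Require Import boolp classical_sets functions.

Set Implicit Arguments.
Unset Strict Implicit.
Unset Printing Implicit Defensive.

Import Order.TTheory GRing.Theory Num.Theory.
Local Open Scope ring_scope.

(* Following Ribet, suppose that every stable lattice whose reduction has the
   shape [rho1 *; 0 rho2] has reduction isomorphic to rho1 (+) rho2.  Such an
   isomorphism forces the extension itself to split.  Write the action on the
   given lattice as [a b; c d] with c = 0 mod pi.  Splitting the reduction of
   one lattice after another yields matrices T_k, with T_(k+1) = T_k mod pi^k,
   such that conjugation by [1 T_k; 0 1] makes the upper right block divisible
   by pi^k.  Over the completion of E (constructed as Cauchy sequences modulo
   null sequences, so that one need not know that E is already complete), the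
   limit of the T_k makes this block vanish, contradicting the absolute
   irreducibility of sigma. *)

(** * The completion of [E] with respect to [v], as a field *)

Section Completion.
Variables (p : nat) (p_prime : prime p) (E : fieldExtType (Qpadic p_prime)).
Variable v : padic_valuation E.
Implicit Types k l : int.

Lemma vball0 k : 0 \in vball v k. Proof. by rewrite inE eqxx. Qed.

Lemma vball_le k l a : k <= l -> a \in vball v l -> a \in vball v k.
Proof. by move=> kl; rewrite !inE => /orP[->//|/(le_trans kl)->]; rewrite orbT. Qed.

Lemma vball_opp k a : (- a \in vball v k) = (a \in vball v k).
Proof.
suff opp b : b \in vball v k -> - b \in vball v k.
  by apply/idP/idP => [/opp|/opp//]; rewrite opprK.
by move=> kb; rewrite -mulN1r -[k]add0r vball_mul // inE pvalN1 lexx orbT.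
Qed.

Lemma vball_sub k a b : a \in vball v k -> b \in vball v k -> a - b \in vball v k.
Proof. by move=> ka kb; rewrite vball_add // vball_opp. Qed.

Lemma vball_inv k a : a \notin vball v k -> a^-1 \in vball v (- k).
Proof.
rewrite !inE negb_or -ltNge => /andP[a0 va].
by rewrite pvalV // lerN2 ltW ?orbT.
Qed.

Definition cauchy : {pred nat -> E} := fun x =>
  `[< forall k, exists N, forall i j, (N <= i)%N -> (N <= j)%N ->
        x i - x j \in vball v k >].

Lemma cauchy_bounded (x : nat -> E) : x \in cauchy ->
  exists k N, forall i, (N <= i)%N -> x i \in vball v k.
Proof.
(* Past [N] each term differs from [x N] by an element of the ball 0, whence the minimum of 0 and
   [v (x N)]. *)
move=> /asboolP/(_ 0)[N xN]; exists (Num.min 0 (v (x N))), N => i Ni.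
rewrite -(subrK (x N) (x i)) vball_add //.
  by apply: vball_le (xN _ _ Ni (leqnn N)); rewrite ge_min lexx.
by rewrite inE ge_min lexx !orbT.
Qed.

Lemma cauchy_subring : subring_closed cauchy.
Proof.
split=> [|x y /asboolP xC /asboolP yC|x y xC yC]; apply/asboolP => k.
- by exists 0%N => i j _ _; rewrite subrr vball0.
- have [[N xN] [M yM]] := (xC k, yC k); exists (maxn N M) => i j.
  rewrite !geq_max => /andP[Ni Mi] /andP[Nj Mj].
  have -> : (x - y) i - (x - y) j = (x i - x j) - (y i - y j).
    by rewrite !fctE !opprB addrACA [RHS]addrACA [- x j + _]addrC.
  by rewrite vball_sub ?xN ?yM.
- have [a [Na xa]] := cauchy_bounded xC; have [b [Nb yb]] := cauchy_bounded yC.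
  (* The factors eventually lie in the balls [a] and [b], so differences in the balls [k - b] and
     [k - a] make both products land in the ball [k]. *)
  have /asboolP/(_ (k - b))[N xN] := xC; have /asboolP/(_ (k - a))[M yM] := yC.
  exists (maxn (maxn Na Nb) (maxn N M)) => i j; rewrite !geq_max.
  move=> /andP[/andP[ai bi] /andP[Ni Mi]] /andP[/andP[aj bj] /andP[Nj Mj]].
  have -> : (x * y) i - (x * y) j = (x i - x j) * y i + x j * (y i - y j).
    by rewrite !fctE mulrBl mulrBr addrA subrK.
  apply: vball_add; first by rewrite -(subrK b k) vball_mul ?xN ?yb.
  by rewrite -(subrKC a k) vball_mul ?xa ?yM.
Qed.

HB.instance Definition _ :=
  GRing.isSubringClosed.Build (nat -> E) cauchy cauchy_subring.

Record cauchy_seq := MkCauchy { cauchy_fun :> nat -> E; cauchyP : cauchy_fun \in cauchy }.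

HB.instance Definition _ := [isSub for cauchy_fun].
HB.instance Definition _ := [Choice of cauchy_seq by <:].
HB.instance Definition _ := [SubChoice_isSubComNzRing of cauchy_seq by <:].

(** Evaluation does not descend to the completion; as a ring morphism on Cauchy sequences it lets
    polynomial expressions be computed term by term. *)
Definition eval_seq (i : nat) (x : cauchy_seq) : E := x i.

Lemma eval_seq_zmod_morphism i : zmod_morphism (eval_seq i).
Proof. by []. Qed.
Lemma eval_seq_monoid_morphism i : monoid_morphism (eval_seq i).
Proof. by []. Qed.
HB.instance Definition _ i :=
  GRing.isZmodMorphism.Build cauchy_seq E (eval_seq i) (eval_seq_zmod_morphism i).
HB.instance Definition _ i :=
  GRing.isMonoidMorphism.Build cauchy_seq E (eval_seq i) (eval_seq_monoid_morphism i).

Lemma const_seq_subproof (a : E) : (fun=> a) \in cauchy.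
Proof. by apply/asboolP => k; exists 0%N => i j _ _; rewrite subrr vball0. Qed.
Definition const_seq (a : E) : cauchy_seq := MkCauchy (const_seq_subproof a).

Lemma const_seq_zmod_morphism : zmod_morphism const_seq.
Proof. by move=> a b; apply/val_inj. Qed.
Lemma const_seq_monoid_morphism : monoid_morphism const_seq.
Proof. by split=> [|a b]; apply/val_inj. Qed.
HB.instance Definition _ :=
  GRing.isZmodMorphism.Build E cauchy_seq const_seq const_seq_zmod_morphism.
HB.instance Definition _ :=
  GRing.isMonoidMorphism.Build E cauchy_seq const_seq const_seq_monoid_morphism.

Definition null_seq : {pred cauchy_seq} := fun x =>
  `[< forall k, exists N, forall i, (N <= i)%N -> eval_seq i x \in vball v k >].

Lemma null_seq_closed : idealr_closed null_seq.
Proof.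
split=> [||a x y /asboolP x0 /asboolP y0].
- by apply/asboolP => k; exists 0%N => i _; rewrite rmorph0 vball0.
- apply/asboolP => /(_ 1)[N /(_ N (leqnn N))].
  by rewrite rmorph1 inE oner_eq0 pval1.
- have [b [M ab]] := cauchy_bounded (cauchyP a); apply/asboolP => k.
  have [[N xN] [K yK]] := (x0 (k - b), y0 k); exists (maxn M (maxn N K)) => i.
  rewrite !geq_max => /and3P[Mi Ni Ki]; rewrite rmorphD rmorphM vball_add ?yK //.
  by rewrite -(subrKC b k) vball_mul ?ab ?xN.
Qed.

HB.instance Definition _ := isIdealr.Build cauchy_seq null_seq null_seq_closed.

Definition completion := {ideal_quot null_seq}.
HB.instance Definition _ := GRing.ComNzRing.on completion.

Definition limit (x : cauchy_seq) : completion := (\pi_completion x)%qT.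

Lemma limit_zmod_morphism : zmod_morphism limit.
Proof. by move=> x y; rewrite /limit !piE. Qed.
Lemma limit_monoid_morphism : monoid_morphism limit.
Proof. by split=> [|x y]; rewrite /limit !piE. Qed.

HB.instance Definition _ :=
  GRing.isZmodMorphism.Build cauchy_seq completion limit limit_zmod_morphism.
HB.instance Definition _ :=
  GRing.isMonoidMorphism.Build cauchy_seq completion limit limit_monoid_morphism.

Lemma limit_eq0 x : (limit x == 0) = (x \in null_seq).
Proof. by rewrite /limit piE Quotient.equivE subr0. Qed.

(** A Cauchy sequence that is not null eventually avoids some ball around 0, so its termwise
    inverses are bounded and again Cauchy. *)
Lemma completion_inv_ex (a : completion) :
  a != 0 -> exists b : completion, b * a = 1.
Proof.
rewrite -[a]reprK -/(limit _) limit_eq0; set x := repr a => /asboolPn.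
move=> /existsNP[k /forallNP x0]; have /asboolP xC := cauchyP x.
(* Once all differences lie in the ball [k], a single term in that ball would draw all later terms
   into it. *)
have {}x0 : exists N, forall i, (N <= i)%N -> x i \notin vball v k.
  have [N xN] := xC k; exists N => i Ni; apply/negP => xi; apply: (x0 N) => j Nj.
  by rewrite /eval_seq -(subrK (x i) (x j)) vball_add ?xN.
have {x0}[M xM] := x0.
have yC : (fun i => (x i)^-1) \in cauchy.
  (* Both inverses lie in the ball [- k]; the shift of [l] by [k + k] compensates for them. *)
  apply/asboolP => l; have [N xN] := xC (l + k + k); exists (maxn M N) => i j.
  rewrite !geq_max => /andP[Mi Ni] /andP[Mj Nj]; have [xi xj] := (xM i Mi, xM j Mj).
  have x0 h : x h \notin vball v k -> x h != 0 by apply: contraNneq => ->; exact: vball0.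
  have -> : (x i)^-1 - (x j)^-1 = (x j - x i) * (x i)^-1 * (x j)^-1.
    by rewrite mulrBl mulrBl mulfV ?x0 // mul1r mulrAC mulfV ?x0 // mul1r addrC.
  rewrite -(addrK k l) -{1}(addrK k (l + k)).
  by rewrite !vball_mul ?vball_inv ?xN.
exists (limit (MkCauchy yC)); apply/eqP; rewrite -subr_eq0 -rmorphM -[1](rmorph1 limit).
rewrite -rmorphB limit_eq0; apply/asboolP => l; exists M => i Mi.
rewrite rmorphB rmorphM rmorph1 /eval_seq /= mulVf ?subrr ?vball0 //.
by apply: contraNneq (xM i Mi) => ->; exact: vball0.
Qed.

Definition completion_inv (a : completion) : completion :=
  if pselect (a != 0) is left a0 then projT1 (cid (completion_inv_ex a0)) else 0.

Lemma completion_mulVf a : a != 0 -> completion_inv a * a = 1.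
Proof. by rewrite /completion_inv; case: pselect => // a0 _; case: cid. Qed.

Lemma completion_inv0 : completion_inv 0 = 0.
Proof. by rewrite /completion_inv; case: pselect => // n0; case/eqP: {-}(n0). Qed.

HB.instance Definition _ :=
  GRing.ComNzRing_isField.Build completion completion_mulVf completion_inv0.

(** The extension of [E] over which [sigma] will be shown to become reducible. *)
Definition completion_emb : E -> completion := limit \o const_seq.
HB.instance Definition _ := GRing.RMorphism.on completion_emb.

End Completion.

(** * Extensions isomorphic to the direct sum are split *)

(** The conclusion says that the columns of [[t; 1]] span a stable complement of [rho1]. Write the
    isomorphism from the direct sum as [Q = [Z X; W Y]]. Then [Y] commutes with [rho2], hence is a
    scalar [y]. If [y] is nonzero, [t = y^-1 X] works. If [y = 0], then [X W] is a nonzero scalar,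
    [W] is an isomorphism from [rho1] to [rho2], and [t = Z W^-1] works. *)
Lemma block_rep_split (G : groupType) (K : fieldType) (n1 n2 : nat)
    (rho1 : G -> 'M[K]_n1) (b : G -> 'M[K]_(n1, n2)) (rho2 : G -> 'M[K]_n2) :
  (0 < n2)%N -> scalar_centralizer rho1 -> scalar_centralizer rho2 ->
  rep_iso (block_rep rho1 b rho2) (dsum_rep rho1 rho2) ->
  exists t, forall g, rho1 g *m t + b g = t *m rho2 g.
Proof.
move=> n2_gt0 centr1 centr2 [P [Q [PQ QP PrP]]].
have rQ g : block_rep rho1 b rho2 g *m Q = Q *m dsum_rep rho1 rho2 g.
  rewrite -[LHS]mul1mx -QP -!mulmxA; congr (_ *m _).
  by rewrite mulmxA PrP -mulmxA PQ mulmx1.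
move: PQ QP rQ {PrP}; rewrite -(submxK P) -(submxK Q).
move: (ulsubmx Q) (ursubmx Q) (dlsubmx Q) (drsubmx Q) => Z X W Y.
move: (ulsubmx P) (ursubmx P) (dlsubmx P) (drsubmx P) => P1 P2 P3 P4.
rewrite !mulmx_block !scalar_mx_block => /eq_block_mx[_ _ _ PQ].
move=> /eq_block_mx[_ _ _ QP] rQ.
have {rQ} rQ g : [/\ rho1 g *m Z + b g *m W = Z *m rho1 g,
    rho1 g *m X + b g *m Y = X *m rho2 g,
    rho2 g *m W = W *m rho1 g & rho2 g *m Y = Y *m rho2 g].
  have := rQ g; rewrite /dsum_rep /block_rep !mulmx_block.
  by rewrite !(mul0mx, mulmx0, add0r, addr0) => /eq_block_mx[].
have /is_scalar_mxP[y Yy] : is_scalar_mx Y by apply: centr2 => g; have [] := rQ g.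
have [y0|y_neq0] := eqVneq y 0; last first.
  exists (y^-1 *: X) => g; have [_ + _ _] := rQ g.
  rewrite -scalemxAr -scalemxAl => <-.
  by rewrite Yy mul_mx_scalar scalerDr scalerA mulVf // scale1r.
rewrite {}Yy {}y0 raddf0 in PQ QP rQ *.
rewrite mul0mx addr0 in QP; rewrite mulmx0 addr0 in PQ.
have {}rQ g : [/\ rho1 g *m Z + b g *m W = Z *m rho1 g,
    rho1 g *m X = X *m rho2 g & rho2 g *m W = W *m rho1 g].
  by have [] := rQ g; rewrite mulmx0 addr0.
have /is_scalar_mxP[s XW] : is_scalar_mx (X *m W).
  apply: centr1 => g; have [_ rX rW] := rQ g.
  by rewrite mulmxA rX -!mulmxA rW.
have s0 : s != 0.
  (* With [Y = 0] the lower right blocks of [P Q = 1] and [Q P = 1] read [P3 X = 1] and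
     [W P2 = 1]. *)
  apply: contraTneq isT => s0; have : P3 *m (X *m W) *m P2 = 1%:M.
    by rewrite mulmxA PQ mul1mx QP.
  rewrite XW s0 raddf0 mulmx0 mul0mx => /matrixP/(_ (Ordinal n2_gt0) (Ordinal n2_gt0)).
  by rewrite !mxE eqxx => /esym/eqP; rewrite oner_eq0.
(* So [P2] is the two-sided inverse of [W]. *)
have P2W : P2 *m W = 1%:M.
  have -> : P2 = s^-1 *: X.
    apply: (scalerI s0); rewrite scalerA divff // scale1r -mul_scalar_mx -XW.
    by rewrite -mulmxA QP mulmx1.
  by rewrite -scalemxAl XW scale_scalar_mx mulVf.
exists (Z *m P2) => g; have [rZ _ rW] := rQ g.
have rP2 : rho1 g *m P2 = P2 *m rho2 g.
  rewrite -[P2 *m _]mulmx1 -QP -mulmxA [rho2 g *m _]mulmxA rW.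
  by rewrite !mulmxA P2W mul1mx.
by rewrite -mulmxA -rP2 mulmxA mulmxA -rZ mulmxDl -[b g *m W *m _]mulmxA QP mulmx1.
Qed.

(** * Integral matrix models of [sigma] and their reductions *)

Section IntegralModels.
Variables (p : nat) (p_prime : prime p) (E : fieldExtType (Qpadic p_prime)).
Variables (v : padic_valuation E) (pi : uniformizer v) (G : groupType) (n : nat).
Variable sigma : G -> 'M[E]_n.

Local Notation O := (vring v).
Local Notation incl := (map_mx (val : O -> E)).
Local Notation redmx := (map_mx (red pi)).

Lemma vring_lift_inv (x : O) : red pi x != 0 -> exists y : O, x * y = 1.
Proof.
rewrite red_eq0 unif_idealE => vx.
have x0 : val x != 0 by apply: contraNneq vx => ->; rewrite inE eqxx.
have vxV : (val x)^-1 \in vball v 0.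
  move: vx; rewrite !inE (negPf x0) -ltNge pvalV // oppr_ge0 => vx.
  by rewrite -ltzD1 add0r vx orbT.
by exists (MkVring vxV); apply/val_inj; rewrite rmorphM /= mulfV.
Qed.

Lemma red_lift m q (M : 'M[residue_field pi]_(m, q)) : exists N, redmx N = M.
Proof.
exists (map_mx (fun a => repr a) M); apply/matrixP => i j.
by rewrite !mxE /red reprK.
Qed.

Lemma red_mx0 m q (M : 'M[O]_(m, q)) :
  redmx M = 0 -> exists N, M = unif pi *: N.
Proof.
move=> /matrixP M0.
have /choice[f Mf] (ij : 'I_m * 'I_q) : exists y, M ij.1 ij.2 = unif pi * y.
  apply/asboolP; rewrite -[`[< _ >]]/(_ \in unif_ideal pi) -red_eq0.
  by have := M0 ij.1 ij.2; rewrite !mxE => ->.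
by exists (\matrix_(i, j) f (i, j)); apply/matrixP => i j; rewrite !mxE -(Mf (i, j)).
Qed.

(** Any lift of [Q] has a determinant with nonzero reduction, that is, a unit of [O], so the
    adjugate yields its inverse; this inverse reduces to [P] because inverses are unique. *)
Lemma red_lift_inv m (P Q : 'M[residue_field pi]_m) : P *m Q = 1%:M ->
  exists P' Q' : 'M[O]_m, [/\ P' *m Q' = 1%:M, Q' *m P' = 1%:M,
    redmx P' = P & redmx Q' = Q].
Proof.
move=> PQ; have [Q' redQ] := red_lift Q.
have Qunit : Q \in unitmx by have := mulmx1_unit PQ; case.
have [|r detr] := @vring_lift_inv (\det Q').
  by rewrite -det_map_mx redQ -unitfE -unitmxE.
have PQ' : (r *: \adj Q') *m Q' = 1%:M.
  by rewrite -scalemxAl mul_adj_mx scale_scalar_mx mulrC detr.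
exists (r *: \adj Q'), Q'; split=> //.
  by rewrite -scalemxAr mul_mx_adj scale_scalar_mx mulrC detr.
rewrite -[LHS]mulmx1 -(mulmx1C PQ) mulmxA -redQ -map_mxM PQ'.
by rewrite map_mx1 mul1mx.
Qed.

(* The columns of B form a basis of E^n whose O-span is stable under G. *)
Definition integral_model m (B : 'M[E]_(n, m)) (A : G -> 'M[O]_m) :=
  (exists Bi, B *m Bi = 1%:M /\ Bi *m B = 1%:M) /\
  forall g, sigma g *m B = B *m incl (A g).

Lemma integral_model_lattice m (B : 'M[E]_(n, m)) A : integral_model B A ->
  [/\ lattice v (col_span v B), lattice_stable sigma (col_span v B)
    & reduction_matrix sigma (col_span v B) (fun g => redmx (A g))].
Proof.
move=> [[Bi [BBi BiB]] sB]; split.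
- by exists m, B; split=> //; apply/row_freeP; exists Bi.
- by move=> g _ [c ->]; exists (A g *m c); rewrite mulmxA sB map_mxM mulmxA.
- by exists B, A; split=> //; split=> //; apply/row_fullP; exists Bi.
Qed.

(** The basis [B] is only known to have independent columns. Writing the generators [C], which span
    [E^n], in terms of [B] gives a right inverse of [B], and this equals its left inverse. *)
Lemma reduction_integral_model m (L : set 'cV[E]_n)
    (tau : G -> 'M[residue_field pi]_m) :
  lattice v L -> reduction_matrix sigma L tau ->
  exists B A, integral_model B A /\ forall g, tau g = redmx (A g).
Proof.
move=> [q [C [Cfree LC]]] [B [A [[Bfull LB] sB tauE]]].
exists B, A; split=> //; split=> //.
have /choice[f Bf] (j : 'I_q) : exists c : 'cV[O]_m, col j C = B *m incl c.
  suff : L (col j C) by rewrite LB.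
  rewrite LC; exists (delta_mx j 0); rewrite colE; congr (_ *m _).
  by apply/matrixP => i k; rewrite !mxE; case: (_ && _); rewrite ?rmorph0 ?rmorph1.
have CB : C = B *m incl (\matrix_(i, j) f j i 0).
  apply/matrixP => i j; transitivity (col j C i 0); first by rewrite mxE.
  by rewrite Bf !mxE; apply: eq_bigr => k _; rewrite !mxE.
have /row_freeP[Ci CCi] := Cfree; have /row_fullP[Bi BiB] := Bfull.
set X := incl _ in CB; exists Bi; split=> //.
have BX : B *m (X *m Ci) = 1%:M by rewrite mulmxA -CB.
suff -> : Bi = X *m Ci by [].
by rewrite -[LHS]mulmx1 -BX (mulmxA Bi) BiB mul1mx.
Qed.

(** The inverse [N'] has entries in [E], not in [O], so the new columns may span a strictly smaller
    lattice. *)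
Lemma integral_model_change m (B : 'M[E]_(n, m)) A A' (N : 'M[O]_m) N' :
  integral_model B A -> incl N *m N' = 1%:M ->
  (forall g, A g *m N = N *m A' g) -> integral_model (B *m incl N) A'.
Proof.
move=> [[Bi [BBi BiB]] sB] NN' AN; split; last first.
  by move=> g; rewrite mulmxA sB -!mulmxA -!map_mxM AN.
exists (N' *m Bi); split; first by rewrite mulmxA -(mulmxA B) NN' mulmx1.
by rewrite -!mulmxA (mulmxA Bi) BiB mul1mx (mulmx1C NN').
Qed.


End IntegralModels.

(* The upper right block after conjugation of [a b; c d] by [1 T; 0 1]. *)
Definition riccati (R : pzRingType) m1 m2 (a : 'M[R]_m1) (b : 'M[R]_(m1, m2))
    (c : 'M[R]_(m2, m1)) (d : 'M[R]_m2) (T : 'M[R]_(m1, m2)) : 'M[R]_(m1, m2) :=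
  a *m T + b - T *m (c *m T + d).

Lemma map_riccati (R R' : pzRingType) (f : {rmorphism R -> R'}) m1 m2 a b c d
    (T : 'M[R]_(m1, m2)) :
  map_mx f (riccati a b c d T) =
  riccati (map_mx f a) (map_mx f b) (map_mx f c) (map_mx f d) (map_mx f T).
Proof. by rewrite /riccati map_mxB !map_mxD !map_mxM map_mxD map_mxM. Qed.

(** * Limits of approximate solutions of the Riccati equation *)

Section Limits.
Variables (p : nat) (p_prime : prime p) (E : fieldExtType (Qpadic p_prime)).
Variables (v : padic_valuation E) (m1 m2 : nat).
Local Notation emb := (map_mx (completion_emb v)).

(** By the ultrametric inequality, any number of consecutive steps from index [N] on add up to an
    element of the ball [N]. *)
Lemma cauchy_step (x : nat -> E) :
  (forall k, x k.+1 - x k \in vball v k%:Z) -> x \in cauchy v.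
Proof.
move=> xS; have xD N k : x (N + k)%N - x N \in vball v N%:Z.
  elim: k => [|k IHk]; first by rewrite addn0 subrr vball0.
  rewrite -(subrK (x (N + k)%N) (x _)) -addrA vball_add // addnS.
  by apply: vball_le (xS _); rewrite lez_nat leq_addr.
apply/asboolP => k; exists `|k|%N => i j ki kj.
apply: (@vball_le _ _ _ _ _ `|k|%N); first exact: ler_norm.
have -> : x i - x j = (x i - x `|k|%N) - (x j - x `|k|%N).
  by rewrite opprB addrA subrK.
by rewrite -(subnKC ki) -(subnKC kj) vball_sub.
Qed.

(** Form the expression over the ring of Cauchy sequences: its value at index [h] is the expression
    for [T h], which lies in the ball [h]. Hence it is null and vanishes in the completion, for all
    [g] with the same [T']. *)
Lemma riccati_limit I (a : I -> 'M[E]_m1) b c (d : I -> 'M[E]_m2)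
    (T : nat -> 'M[E]_(m1, m2)) :
  (forall k i j, (T k.+1 - T k) i j \in vball v k%:Z) ->
  (forall g k i j, riccati (a g) (b g) (c g) (d g) (T k) i j \in vball v k%:Z) ->
  exists T', forall g, riccati (emb (a g)) (emb (b g)) (emb (c g)) (emb (d g)) T' = 0.
Proof.
move=> TS FT.
have TC i j : (fun k => T k i j) \in cauchy v.
  by apply: cauchy_step => k; have := TS k i j; rewrite !mxE.
pose T' := \matrix_(i, j) MkCauchy (TC i j).
have embE q r (M : 'M[E]_(q, r)) :
    emb M = map_mx (@limit _ _ _ v) (map_mx (@const_seq _ _ _ v) M).
  by apply/matrixP => i j; rewrite !mxE.
exists (map_mx (@limit _ _ _ v) T') => g; rewrite !embE -map_riccati.
apply/matrixP => i j; rewrite [LHS]mxE [RHS]mxE; apply/eqP; rewrite limit_eq0.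
apply/asboolP => k; exists `|k|%N => h kh.
apply: (@vball_le _ _ _ _ _ h%:Z); first by rewrite (le_trans (ler_norm k)) // -abszE lez_nat.
have evE q r (M : 'M[E]_(q, r)) :
    map_mx (@eval_seq _ _ _ v h) (map_mx (@const_seq _ _ _ v) M) = M.
  by apply/matrixP => i' j'; rewrite !mxE.
set M := riccati _ _ _ _ _.
have -> : eval_seq h (M i j) = map_mx (@eval_seq _ _ _ v h) M i j by rewrite [RHS]mxE.
rewrite map_riccati !evE.
suff -> : map_mx (@eval_seq _ _ _ v h) T' = T h by [].
by apply/matrixP => i' j'; rewrite !mxE.
Qed.

End Limits.

(** * From a Riccati solution to a stable subspace *)

(** The equation says [[a b; c d] [T; 1] = [T; 1] (c T + d)], so the columns of [W = B [T; 1]] span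
    a stable subspace. *)
Lemma riccati_reducible (G : groupType) (K : fieldType) n m1 m2
    (sigma : G -> 'M[K]_n) (B : 'M[K]_(n, m1 + m2)) Bi
    (a : G -> 'M[K]_m1) b c (d : G -> 'M[K]_m2) T :
  (0 < m1)%N -> (0 < m2)%N -> Bi *m B = 1%:M ->
  (forall g, sigma g *m B = B *m block_mx (a g) (b g) (c g) (d g)) ->
  (forall g, riccati (a g) (b g) (c g) (d g) T = 0) ->
  ~ irreducible sigma.
Proof.
move=> m1_gt0 m2_gt0 BiB sB FT [_ irr].
have cst0 q : (0 < q)%N -> const_mx 1 != 0 :> 'cV[K]_q.
  move=> q0; apply/eqP => /matrixP/(_ (Ordinal q0) 0); rewrite !mxE => /eqP.
  by rewrite oner_eq0.
pose W := B *m col_mx T 1%:M.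
have sW g : sigma g *m W = W *m (c g *m T + d g).
  rewrite mulmxA sB -!mulmxA mul_block_col mul_col_mx !mulmx1 mul1mx.
  by congr (B *m col_mx _ _); apply/eqP; rewrite -subr_eq0 -[_ - _]/(riccati _ _ _ _ _) FT.
have BiW : Bi *m W = col_mx T 1%:M by rewrite mulmxA BiB mul1mx.
have [|U0|UT] := irr (limg (linfun (mulmx W : 'cV_m2 -> 'cV_n))).
- move=> g _ /memv_imgP[x _ ->]; rewrite lfunE /= mulmxA sW -mulmxA.
  by rewrite -[W *m _](lfunE (mulmx W)) memv_img ?memvf.
- have : W *m const_mx 1 \in limg (linfun (mulmx W : 'cV_m2 -> 'cV_n)).
    by rewrite -[W *m _](lfunE (mulmx W)) memv_img ?memvf.
  rewrite U0 memv0 => /eqP/(congr1 (mulmx Bi)); rewrite mulmx0 mulmxA BiW.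
  rewrite mul_col_mx mul1mx -[0 in RHS]col_mx0 => /eq_col_mx[_].
  by apply/eqP/cst0.
(* In a vector [[T x; x]] a zero lower block forces the upper one to vanish, so the subspace is
   proper. *)
- have : B *m col_mx (const_mx 1) 0 \in limg (linfun (mulmx W : 'cV_m2 -> 'cV_n)).
    by rewrite UT memvf.
  case/memv_imgP => x _; rewrite lfunE /= => /(congr1 (mulmx Bi)).
  rewrite (mulmxA Bi B) (mulmxA Bi W) BiB BiW mul1mx mul_col_mx mul1mx => /eq_col_mx[+ x0].
  by rewrite -x0 mulmx0; apply/eqP/cst0.
Qed.

(** * Successive approximation of a Riccati solution *)

(** Taylor expansion at [T]: the bracket is the linear term in [t] plus a quadratic remainder
    carrying another factor [q]. *)
Lemma riccati_addZ (R : comPzRingType) m1 m2 (a : 'M[R]_m1) b c (d : 'M[R]_m2)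
    (T t : 'M[R]_(m1, m2)) q :
  riccati a b c d (T + q *: t) = riccati a b c d T +
    q *: (a *m t - (t *m (c *m T + d) + T *m c *m t + q *: (t *m c *m t))).
Proof.
have E : c *m (T + q *: t) + d = (c *m T + d) + q *: (c *m t).
  by rewrite mulmxDr -scalemxAr addrAC.
rewrite /riccati {}E; move: (c *m T + d) => y.
rewrite !mulmxDr !mulmxDl -!scalemxAr -!scalemxAl !mulmxA scalerBr !scalerDr.
move: (a *m T) (T *m y) (q *: (a *m t)) (q *: (t *m y)) => x1 x2 u w.
move: (q *: (T *m c *m t)) (q *: (q *: _)) => w1 w2.
by rewrite (addrAC x1) -(addrA x2) (addrA w) opprD addrACA.
Qed.

Section Approximation.
Variables (p : nat) (p_prime : prime p) (E : fieldExtType (Qpadic p_prime)).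
Variables (v : padic_valuation E) (pi : uniformizer v) (G : groupType) (n : nat).
Variables (sigma : G -> 'M[E]_n) (n1 n2 : nat).
Variables (rho1 : G -> 'M[residue_field pi]_n1) (rho2 : G -> 'M[residue_field pi]_n2).

Local Notation O := (vring v).
Local Notation incl := (map_mx (val : O -> E)).
Local Notation redmx := (map_mx (red pi)).

(** The form in which the assumed absence of the desired lattice enters the approximation. *)
Hypothesis models_split : forall B A b, integral_model sigma B A ->
  (forall g, redmx (A g) = block_rep rho1 b rho2 g) ->
  exists t, forall g, rho1 g *m t + b g = t *m rho2 g.

Variables (B : 'M[E]_(n, n1 + n2)) (a : G -> 'M[O]_n1) (b : G -> 'M[O]_(n1, n2)).
Variables (c : G -> 'M[O]_(n2, n1)) (d : G -> 'M[O]_n2).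
Hypothesis model : integral_model sigma B (fun g => block_mx (a g) (b g) (c g) (d g)).
Hypotheses (red_a : forall g, redmx (a g) = rho1 g) (red_c : forall g, redmx (c g) = 0).
Hypothesis red_d : forall g, redmx (d g) = rho2 g.

Lemma unif_pow_neq0 k : val (unif pi ^+ k) != 0.
Proof. by rewrite rmorphXn expf_neq0 //; exact: unif_neq0. Qed.

(* The lattice spanned by B [pi^k T; 0 1] is stable, and its reduction has
   upper right block the reduction of beta. *)
Lemma approximation_step k (T : 'M[O]_(n1, n2)) beta :
  (forall g, riccati (a g) (b g) (c g) (d g) T = unif pi ^+ k *: beta g) ->
  exists t beta', forall g,
    riccati (a g) (b g) (c g) (d g) (T + unif pi ^+ k *: t) = unif pi ^+ k.+1 *: beta' g.
Proof.
set q := unif pi ^+ k => FT; have q0 : val q != 0 := unif_pow_neq0 k.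
pose N : 'M[O]_(n1 + n2) := block_mx q%:M T 0 1%:M.
(* This is the conjugate of [[a b; c d]] by [N] over [E]; its upper right block is the Riccati
   expression divided by [q]. *)
pose A' g := block_mx (a g - T *m c g) (beta g) (q *: c g) (c g *m T + d g).
have model' : integral_model sigma (B *m incl N) A'.
  apply: (integral_model_change
    (N' := block_mx (val q)^-1%:M (- ((val q)^-1 *: incl T)) 0 1%:M) model).
    rewrite map_block_mx map_scalar_mx map_mx0 map_mx1 mulmx_block.
    rewrite !(mul0mx, mulmx0, addr0, add0r, mulmx1) -scalar_mxM divff //.
    by rewrite mul_scalar_mx scalerN scalerA divff // scale1r addNr -scalar_mx_block.
  move=> g; rewrite !mulmx_block !(mul0mx, mulmx0, addr0, add0r, mulmx1, mul1mx).
  rewrite !mul_mx_scalar !mul_scalar_mx -FT /riccati subrK.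
  by rewrite scalerBr -scalemxAr subrK.
have [t tE] : exists t, forall g, rho1 g *m t + redmx (beta g) = t *m rho2 g.
  apply: models_split model' _ => g.
  (* The lower left block [q c] vanishes modulo [pi] even for [k = 0], since [c] does. *)
  rewrite map_block_mx map_mxB !map_mxZ map_mxD !map_mxM red_a red_c red_d.
  by rewrite mulmx0 subr0 scaler0 mul0mx add0r.
have [t' redt] := red_lift t.
(* Modulo [pi] all terms with [c] drop out, and what remains is the splitting relation for [t]; this
   gains the next factor [pi]. *)
exists t'; have /choice[f fE] g : exists N', a g *m t' + beta g
    - (t' *m (c g *m T + d g) + T *m c g *m t' + q *: (t' *m c g *m t')) = unif pi *: N'.
  apply: red_mx0; rewrite map_mxB !map_mxD map_mxZ !map_mxM map_mxD !map_mxM.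
  by rewrite red_a red_c red_d redt tE !(mul0mx, mulmx0, scaler0, add0r, addr0) subrr.
exists f => g; rewrite exprSr -scalerA -fE riccati_addZ FT -scalerDr.
by rewrite addrA [beta g + _]addrC.
Qed.

Lemma approximations : exists T : nat -> 'M[O]_(n1, n2),
  (forall k, exists t, T k.+1 = T k + unif pi ^+ k *: t) /\
  (forall k, exists beta, forall g,
    riccati (a g) (b g) (c g) (d g) (T k) = unif pi ^+ k *: beta g).
Proof.
pose P (k : nat) T := exists beta, forall g,
  riccati (a g) (b g) (c g) (d g) T = unif pi ^+ k *: beta g.
(* Corrections are chosen for all pairs at once, with value 0 where [P] fails, so that the recursion
   need not carry proofs. *)
have /choice[f fP] (kT : nat * 'M[O]_(n1, n2)) :
    exists t, P kT.1 kT.2 -> P kT.1.+1 (kT.2 + unif pi ^+ kT.1 *: t).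
  have [[beta FT]|nP] := pselect (P kT.1 kT.2); last by exists 0.
  by have [t [beta' FT']] := approximation_step FT; exists t => _; exists beta'.
pose T := fix T k := if k is k'.+1 then T k' + unif pi ^+ k' *: f (k', T k') else 0.
exists T; split=> [k|]; first by exists (f (k, T k)).
elim=> [|k IHk]; last exact: (fP (k, T k)).
by exists b => g; rewrite /= expr0 scale1r /riccati mulmx0 mul0mx subr0 add0r.
Qed.

(** Divisibility by [pi^k] is membership in the ball [k], so the approximations converge to a
    Riccati solution over the completion, where [sigma] becomes reducible. *)
Lemma model_not_absolutely_irreducible :
  (0 < n1)%N -> (0 < n2)%N -> ~ absolutely_irreducible sigma.
Proof.
move=> n1_gt0 n2_gt0 irr; have [T [TS FT]] := approximations.
have ballE k (x : O) : val (unif pi ^+ k * x) \in vball v k%:Z.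
  rewrite -[k%:Z]addr0 rmorphM vball_mul ?vringP //.
  elim: k => [|k IHk]; first by rewrite expr0 rmorph1 inE pval1 lexx orbT.
  rewrite exprSr rmorphM -addn1 PoszD vball_mul //.
  by rewrite inE pval_unif lexx orbT.
have [|g k i j|T' FT'] := riccati_limit (a := fun g => incl (a g))
  (b := fun g => incl (b g)) (c := fun g => incl (c g)) (d := fun g => incl (d g))
  (T := fun k => incl (T k)) (v := v).
- move=> k i j; have [t ->] := TS k.
  by rewrite -map_mxB addrAC subrr add0r !mxE ballE.
- by have [beta FTk] := FT k; rewrite -map_riccati FTk !mxE ballE.
have [[Bi [_ BiB]] sB] := model.
apply: (riccati_reducible (Bi := map_mx (completion_emb v) Bi)
  (B := map_mx (completion_emb v) B) n1_gt0 n2_gt0 _ _ FT' (irr _ (completion_emb v))).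
- by rewrite -map_mxM BiB map_mx1.
- by move=> g /=; rewrite -!map_block_mx -!map_mxM sB.
Qed.

End Approximation.

(** * Existence of a lattice with non-split reduction *)

Theorem theorem4p1 (S : seq nat) (S_primes : all prime S)
    (p : nat) (p_prime : prime p) (E : fieldExtType (Qpadic p_prime))
    (v : padic_valuation E) (pi : uniformizer v)
    (n : nat) (sigma : GS S -> 'M[E]_n)
    (sigma_rep : galois_rep v sigma)
    (sigma_irr : absolutely_irreducible sigma)
    (n1 n2 : nat) (n1_gt0 : (0 < n1)%N) (n2_gt0 : (0 < n2)%N)
    (rho1 : GS S -> 'M[residue_field pi]_n1)
    (rho2 : GS S -> 'M[residue_field pi]_n2)
    (rho1_rep : residual_galois_rep rho1)
    (rho2_rep : residual_galois_rep rho2)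
    (rho1_centr : scalar_centralizer rho1)
    (rho2_centr : scalar_centralizer rho2)
    (rho1_semisimple : semisimple rho1)
    (rho1_ss : GS S -> 'M[residue_field pi]_n1)
    (rho2_ss : GS S -> 'M[residue_field pi]_n2)
    (rho1_ssP : semisimplification rho1 rho1_ss)
    (rho2_ssP : semisimplification rho2 rho2_ss)
    (no_common : forall (m1 m2 : nat)
       (tau1 : GS S -> 'M[residue_field pi]_m1)
       (tau2 : GS S -> 'M[residue_field pi]_m2),
       irreducible_constituent rho1_ss tau1 ->
       irreducible_constituent rho2_ss tau2 ->
       ~ rep_iso tau1 tau2)
    (L : set 'cV[E]_n) (L_lattice : lattice v L)
    (L_stable : lattice_stable sigma L)
    (L_red : exists b : GS S -> 'M[residue_field pi]_(n1, n2),
       reduction_iso sigma L (block_rep rho1 b rho2)) :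
  exists L' : set 'cV[E]_n,
    [/\ lattice v L', lattice_stable sigma L'
      & exists b : GS S -> 'M[residue_field pi]_(n1, n2),
          reduction_iso sigma L' (block_rep rho1 b rho2) /\
          ~ rep_iso (block_rep rho1 b rho2) (dsum_rep rho1 rho2)].
Proof.
apply: contrapT => nL'.
have models_split B A b : integral_model sigma B A ->
    (forall g, map_mx (red pi) (A g) = block_rep rho1 b rho2 g) ->
    exists t, forall g, rho1 g *m t + b g = t *m rho2 g.
  (* If the reduction were not isomorphic to the direct sum, the span of [B] would be a lattice of
     the kind assumed not to exist. *)
  move=> BA redA; apply: block_rep_split => //; apply: contrapT => nsplit.
  have [latB stabB redB] := integral_model_lattice pi BA.
  apply: nL'; exists (col_span v B); split=> //; exists b; split=> //.
  exists (fun g => map_mx (red pi) (A g)); split=> //.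
  exists 1%:M, 1%:M; split=> [||g]; rewrite ?mulmx1 ?mul1mx //.
have [b [tau [redL [P [Q [PQ QP Ptau]]]]]] := L_red.
have [B [A [BA tauE]]] := reduction_integral_model L_lattice redL.
have [P' [Q' [PQ' QP' redP redQ]]] := red_lift_inv PQ.
(* Lifting the isomorphism to an invertible matrix over [O] changes the basis so that the reduction
   is equal, not just isomorphic, to the block form. *)
pose A' g := P' *m A g *m Q'.
have modelA' : integral_model sigma (B *m map_mx val Q') A'.
  apply: (integral_model_change (N' := map_mx val P') BA) => [|g].
    by rewrite -map_mxM QP' map_mx1.
  by rewrite /A' !mulmxA QP' mul1mx.
have redA' g : map_mx (red pi) (A' g) = block_rep rho1 b rho2 g.
  by rewrite !map_mxM redP redQ -tauE Ptau -mulmxA PQ mulmx1.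
have A'E g : A' g = block_mx (ulsubmx (A' g)) (ursubmx (A' g)) (dlsubmx (A' g))
    (drsubmx (A' g)) by rewrite submxK.
have modelE : integral_model sigma (B *m map_mx val Q') (fun g =>
    block_mx (ulsubmx (A' g)) (ursubmx (A' g)) (dlsubmx (A' g)) (drsubmx (A' g))).
  by case: modelA' => Bi sB; split=> // g; rewrite -A'E.
have {}redA' g : [/\ map_mx (red pi) (ulsubmx (A' g)) = rho1 g,
    map_mx (red pi) (dlsubmx (A' g)) = 0 & map_mx (red pi) (drsubmx (A' g)) = rho2 g].
  by have := redA' g; rewrite {1}A'E map_block_mx => /eq_block_mx[].
apply: (model_not_absolutely_irreducible models_split modelE) sigma_irr => // g;
  by have [] := redA' g.
Qed.
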